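(* Let $\gamma:\mathbb T\to\mathbb R^2$ be a $C^2$ embedded Jordan curve (a $C^2$ embedding of $\mathbb T=\mathbb R/\mathbb Z$) with $\inf_{t\in\mathbb T}|\gamma'(t)|>0$. If $\eta$ is a nonzero finite Borel measure supported on $\gamma(\mathbb T)$, then $$\dim_{\mathrm F}(\eta)\le\alpha_{\min}(\eta).$$ In particular, this conclusion applies when $\gamma$ is any nondegenerate $C^2$ Jordan curve, i.e. a $C^2$ embedding of $\mathbb T$ with $\inf_{\mathbb T}|\gamma'|>0$ and $\inf_{\mathbb T}|\det(\gamma',\gamma'')|>0$.
   Context: Derivatives of $\gamma:\mathbb T\to\mathbb R^2$ are those of the associated $1$-periodic $C^2$ map on $\mathbb R$. For a finite Borel measure $\eta$ on $\mathbb R^2$, $\widehat\eta(\xi)=\int e^{-2\pi ix\cdot\xi}\,d\eta(x)$. For nonzero $\eta$, $\dim_{\mathrm F}(\eta)=\sup\{0\le\sigma\le2:\ |\widehat\eta(\xi)|=O(|\xi|^{-\sigma/2})\text{ as }|\xi|\to\infty\}$ and $$\alpha_{\min}(\eta)=\inf_{x\in\operatorname{spt}\eta}\ \liminf_{\rho\downarrow0}\frac{\log_2\eta(B(x,\rho))}{\log_2\rho}.$$ *)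

(* Defs.v *)
From HB Require Import structures.
From mathcomp Require Import all_boot all_order all_algebra.
From mathcomp Require Import all_classical all_reals all_analysis.
From mathcomp Require Import complex.

Set Implicit Arguments.
Unset Strict Implicit.
Unset Printing Implicit Defensive.

Import Order.TTheory GRing.Theory Num.Theory.
Import numFieldNormedType.Exports.
Local Open Scope classical_set_scope.
Local Open Scope ring_scope.

(** ** The Euclidean plane *)

(* The canonical norm and balls of [R * R] are those of the sup norm, so the
   Euclidean ones are defined here. The topologies agree, and the product
   sigma-algebra carried by [R * R] is the Borel sigma-algebra of the plane. *)
Section plane.
Context {R : realType}.
Implicit Types x y : R * R.

Definition dotp x y : R := x.1 * y.1 + x.2 * y.2.

Definition enorm x : R := Num.sqrt (dotp x x).

Definition eball x (r : R) : set (R * R) := [set y | enorm (y - x) < r].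

Definition det2 x y : R := x.1 * y.2 - x.2 * y.1.

End plane.

(** ** Closed plane curves *)

(* A map on R/Z is represented by its 1-periodic lift to [R]. *)
Section curves.
Context {R : realType}.
Implicit Type gamma : R -> R * R.

Definition one_periodic gamma := forall t, gamma (t + 1) = gamma t.

Definition class_C2 gamma :=
  [/\ forall t, derivable gamma t 1,
      forall t, derivable (derive1 gamma) t 1
    & continuous (derive1n 2 gamma)].

Definition injective_mod1 gamma :=
  forall s t, gamma s = gamma t -> exists k : int, s - t = k%:~R.

(* R/Z being compact, an injective continuous map is a homeomorphism onto its
   image. The non-vanishing of the derivative is not part of this notion: it
   is stated separately by [regular_curve]. *)
Definition C2_Jordan_curve gamma :=
  [/\ one_periodic gamma, class_C2 gamma & injective_mod1 gamma].

Definition regular_curve gamma :=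
  0 < inf [set enorm (derive1 gamma t) | t in [set: R]].

Definition nondegenerate_C2_Jordan_curve gamma :=
  [/\ C2_Jordan_curve gamma, regular_curve gamma
    & 0 < inf [set `|det2 (derive1 gamma t) (derive1n 2 gamma t)| | t in [set: R]]].

End curves.

(** ** Dimensions of measures on the plane *)

Section dimensions.
Context {R : realType}.
Variable eta : {finite_measure set (R * R)%type -> \bar R}.

(* [\int e^(-2 i pi x . xi) d eta(x)], written in terms of its real and
   imaginary parts. *)
Definition fourier (xi : R * R) : R[i] :=
  ((\int[eta]_x cos (- 2 * pi * dotp x xi))
   +i* (\int[eta]_x sin (- 2 * pi * dotp x xi)))%C.

Definition fourier_decay (sigma : R) :=
  exists C M : R, forall xi : R * R, M <= enorm xi ->
    complex.Re `|fourier xi| <= C * enorm xi `^ (- (sigma / 2)).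

Definition dimF : R :=
  sup [set sigma | 0 <= sigma <= 2 /\ fourier_decay sigma].

Definition spt : set (R * R) :=
  [set x | forall U : set (R * R), open U -> U x -> (0 < eta U)%E].

Definition log2 (x : R) : R := ln x / ln 2.

Definition lower_local_dim (x : R * R) : \bar R :=
  limf_einf (fun rho : R => (log2 (fine (eta (eball x rho))) / log2 rho)%:E)
    0^'+.

Definition alpha_min : \bar R := ereal_inf [set lower_local_dim x | x in spt].

End dimensions.

(* Main.v *)
(** Let [x] be a point of the curve and [nu] the unit normal there. As the
    curve is regular, simple and twice differentiable, its part in the ball
    [B(x, r)] lies in the strip [|(y - x) . nu| <= K r^2]. On that strip the
    Fejer kernel [\sum_(j, k < N) cos (2 pi (j - k) (y - x) . nu)], with [N] of
    order [r^-2], is at least [N^2 / 4]; it is nonnegative everywhere, and its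
    integral against [eta] only involves the Fourier transform at the
    frequencies [m nu] with [|m| < N]. Decay of order [|xi|^(-s/2)] with
    [s < 2] makes this integral [O(N^(2 - s/2))], so that
    [eta (B(x, r)) = O(N^(-s/2)) = O(r^s)]. *)
Require Import Defs.
From HB Require Import structures.
From mathcomp Require Import all_boot all_order all_algebra.
From mathcomp Require Import all_classical all_reals all_analysis.
From mathcomp Require Import complex measurable_realfun ring lra.
Import Order.TTheory GRing.Theory Num.Theory.
Import numFieldNormedType.Exports.
Local Open Scope classical_set_scope.
Local Open Scope ring_scope.

Set Implicit Arguments.
Unset Strict Implicit.
Unset Printing Implicit Defensive.

(** * Borel sets of the plane *)

(** The sigma-algebra on [R * R] is the product one, so openness is traded for a countable union:
    every point of [A] lies in a half-open rectangle with rational corners contained in [A]. *)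
Lemma open_measurable_plane (R : realType) (A : set (R * R)) :
  open A -> measurable A.
Proof.
move=> oA.
pose B (q : (rat * rat) * (rat * rat)) : set (R * R) :=
  [set` `]ratr q.1.1, ratr q.1.2[%R] `*` [set` `]ratr q.2.1, ratr q.2.2[%R].
have -> : A = \bigcup_q (if `[< B q `<=` A >] then B q else set0).
  apply/seteqP; split => [[x1 x2] Ax|x [q _]]; last by case: asboolP => // /[apply].
  have := open_nbhs_nbhs (conj oA Ax).
  rewrite -nbhs_ballE => -[/= e e0 eA].
  have le (z : R) : z - e < z by rewrite gtrBl.
  have re (z : R) : z < z + e by rewrite ltrDl.
  have [a1] := rat_in_itvoo (le x1); have [b1] := rat_in_itvoo (re x1).
  have [a2] := rat_in_itvoo (le x2); have [b2] := rat_in_itvoo (re x2).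
  rewrite !in_itv /= => /andP[? ?] /andP[? ?] /andP[? ?] /andP[? ?].
  exists ((a1, b1), (a2, b2)) => //.
  case: asboolP => [_|[]]; first by split; rewrite /= in_itv/=; apply/andP.
  move=> [y1 y2] [/=]; rewrite !in_itv /= => /andP[? ?] /andP[? ?].
  apply: eA; split; rewrite /ball /= ltr_norml; apply/andP; split; lra.
apply: countable_bigcupT_measurable => [|q]; first exact: countableP.
case: asboolP => // _; exact: measurableX.
Qed.

(** * Boundedness and decay of the Fourier transform *)

Section fourier_bounds.
Variables (R : realType) (eta : {finite_measure set (R * R)%type -> \bar R}).

Lemma measurable_dotp (xi : R * R) :
  measurable_fun [set: R * R] (fun x : R * R => dotp x xi).
Proof.
by apply: measurable_funD; apply: measurable_funM => //.
Qed.

Lemma bounded_measurable_integrable (c : R) (f : R * R -> R) :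
  measurable_fun setT f -> (forall x, `|f x| <= c) ->
  eta.-integrable setT (EFin \o f).
Proof.
move=> mf fc; apply: measurable_bounded_integrable => //.
  by rewrite -ge0_fin_numE// fin_num_measure.
exists c; split; first by rewrite num_real.
by move=> x cx y _; apply: le_trans (ltW cx).
Qed.

Lemma integrable_cos (f : R * R -> R) : measurable_fun setT f ->
  eta.-integrable setT (EFin \o (cos \o f)).
Proof.
move=> mf; apply: (@bounded_measurable_integrable 1) => [|x].
  by apply: measurableT_comp => //; apply: continuous_measurable_fun; exact: continuous_cos.
exact: cos_max.
Qed.

Lemma integrable_sin (f : R * R -> R) : measurable_fun setT f ->
  eta.-integrable setT (EFin \o (sin \o f)).
Proof.
move=> mf; apply: (@bounded_measurable_integrable 1) => [|x].
  by apply: measurableT_comp => //; apply: continuous_measurable_fun; exact: continuous_sin.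
exact: sin_max.
Qed.

Lemma le_Rintegral_mass (f : R * R -> R) :
  measurable_fun setT f -> (forall x, `|f x| <= 1) ->
  `|\int[eta]_x f x| <= fine (eta setT).
Proof.
move=> mf f1.
apply: le_trans (le_normr_Rintegral _ _) _ => //.
  exact: bounded_measurable_integrable f1.
rewrite -[leRHS]mul1r -Rintegral_cst//; apply: le_Rintegral => //.
- apply: (@bounded_measurable_integrable 1) => [|x]; last by rewrite normr_id.
  exact: measurableT_comp.
- by apply: (@bounded_measurable_integrable 1) => [|x]; rewrite ?normr1.
Qed.

Lemma Re_normc (z : R[i]) :
  complex.Re `|z| = Num.sqrt (complex.Re z ^+ 2 + complex.Im z ^+ 2).
Proof. by case: z. Qed.

Lemma fourier_le_mass (xi : R * R) :
  complex.Re `|fourier eta xi| <= 2 * fine (eta setT).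
Proof.
have mf : measurable_fun setT (fun x : R * R => - 2 * pi * dotp x xi).
  by apply: measurable_funM => //; exact: measurable_dotp.
have T0 : 0 <= fine (eta setT) by exact: fine_ge0.
rewrite Re_normc -(ler_sqr (sqrtr_ge0 _)) ?nnegrE ?mulr_ge0// sqr_sqrtr ?addr_ge0 ?sqr_ge0//=.
have h (c : R) : `|c| <= fine (eta setT) -> c ^+ 2 <= fine (eta setT) ^+ 2.
  by move=> cT; rewrite -[leLHS]real_normK ?num_real// lerXn2r ?nnegrE.
have hc : `|\int[eta]_x cos (- 2 * pi * dotp x xi)| <= fine (eta setT).
  apply: le_Rintegral_mass => [|x]; last exact: cos_max.
  by apply: measurableT_comp => //; apply: continuous_measurable_fun; exact: continuous_cos.
have hs : `|\int[eta]_x sin (- 2 * pi * dotp x xi)| <= fine (eta setT).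
  apply: le_Rintegral_mass => [|x]; last exact: sin_max.
  by apply: measurableT_comp => //; apply: continuous_measurable_fun; exact: continuous_sin.
by rewrite exprMn; move: (h _ hc) (h _ hs); nra.
Qed.

Lemma fourier_decay_le (s s' : R) : s' <= s -> fourier_decay eta s -> fourier_decay eta s'.
Proof.
(* Powers are monotone in the exponent only for bases at least 1, hence the threshold
   [Num.max M 1]. *)
move=> s's [C [M CM]]; exists `|C|, (Num.max M 1) => xi.
rewrite ge_max => /andP[Mxi xi1]; apply: le_trans (CM _ Mxi) _.
apply: (@le_trans _ _ (`|C| * enorm xi `^ (- (s / 2)))).
  by rewrite ler_wpM2r ?powR_ge0// ler_norm.
by rewrite ler_wpM2l// ler_powR// lerN2 ler_pM2r.
Qed.

(** Makes the set whose supremum is [dimF] nonempty. *)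
Lemma fourier_decay0 : fourier_decay eta 0.
Proof.
exists (2 * fine (eta setT)), 0 => xi _; rewrite mul0r oppr0 powRr0 mulr1.
exact: fourier_le_mass.
Qed.

(** The Fejer sum uses low frequencies too, so the threshold has to go. Below [M'] the transform is
    at most twice the mass, while [enorm xi] to the power [- (s / 2)] is at least the same power of
    [M']; enlarging the constant covers this range. *)
Lemma fourier_decay_bound (s : R) : 0 <= s -> fourier_decay eta s ->
  exists2 C : R, 0 <= C & forall xi, 0 < enorm xi ->
    complex.Re `|fourier eta xi| <= C * enorm xi `^ (- (s / 2)).
Proof.
move=> s0 [C [M CM]].
pose M' := Num.max M 1.
have M0 : 0 < M' by rewrite lt_max ltr01 orbT.
have T0 : 0 <= fine (eta setT) by exact: fine_ge0.
exists (`|C| + 2 * fine (eta setT) * M' `^ (s / 2)).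
  by rewrite addr_ge0// !mulr_ge0// powR_ge0.
move=> xi xi0; have [Mxi|xiM] := leP M' (enorm xi).
  have Mxi' : M <= enorm xi by apply: le_trans Mxi; rewrite le_max lexx.
  apply: le_trans (CM _ Mxi') _; rewrite ler_wpM2r ?powR_ge0//.
  by apply: ler_wpDr (ler_norm _); rewrite !mulr_ge0// powR_ge0.
apply: le_trans (fourier_le_mass _) _.
rewrite [leRHS]mulrDl. apply: ler_wpDl; first by rewrite mulr_ge0 ?powR_ge0.
rewrite -[leRHS]mulrA; apply: ler_peMr; first by rewrite mulr_ge0.
rewrite powRN ler_pdivlMr ?powR_gt0// mul1r.
by rewrite ge0_ler_powR ?nnegrE ?divr_ge0// ?(ltW M0) ?(ltW xiM)// ltW.
Qed.

End fourier_bounds.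

(** * Sums of negative powers *)

(* The increment [N^b - (N-1)^b] of a concave power dominates its final slope
   [b N^(b-1)]; this is Young's inequality with exponents [1/b], [1/(1-b)]. *)
Lemma powR_increment (R : realType) (a : R) (n : nat) : 0 <= a < 1 ->
  n%:R `^ (1 - a) + (1 - a) * n.+1%:R `^ (- a) <= n.+1%:R `^ (1 - a).
Proof.
move=> /andP[]; rewrite le_eqVlt => /predU1P[<- _|a0 a1].
  by rewrite subr0 oppr0 powRr0 !powRr1// mul1r natr1.
set x : R := n.+1%:R.
have x0 : 0 < x by rewrite ltr0n.
set y : R := n%:R.
have xE : x = y + 1 by rewrite /x /y natr1.
have b0 : 0 < 1 - a by rewrite subr_gt0.
have y0 : 0 <= y by [].
have H := @conjugate_powR R (y `^ (1 - a)) (x `^ a) (1 - a)^-1 a^-1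
  (powR_ge0 _ _) (powR_ge0 _ _).
move: H; rewrite !invr_gt0 => /(_ b0 a0); rewrite !invrK subrK => /(_ erefl).
rewrite -!powRrM !divff ?gt_eqF// !powRr1 ?(ltW x0)// => H.
(* Multiplied by [x^a], the claim reads [y^(1-a) x^a + (1-a) <= x]. Young bounds the left side by
   [(1-a) y + a x + (1-a)], which equals [x] because [x = y + 1]. *)
have xa0 : 0 < x `^ a by rewrite powR_gt0.
rewrite -(ler_pM2r xa0) mulrDl -mulrA -!powRD ?(gt_eqF x0) ?implybT//.
rewrite addNr subrK powRr0 powRr1 ?(ltW x0)//.
apply: le_trans (lerD H (lexx _)) _; rewrite xE; lra.
Qed.

(** Each term is bounded by a multiple of an increment of [m^(1-a)], and the increments
    telescope. *)
Lemma sum_powRN_le (R : realType) (a : R) (n : nat) : 0 <= a < 1 ->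
  \sum_(1 <= m < n.+1) m%:R `^ (- a) <= (1 - a)^-1 * n%:R `^ (1 - a).
Proof.
move=> a01; have b0 : 0 < 1 - a by rewrite subr_gt0; case/andP: a01.
elim: n => [|n IH]; first by rewrite big_geq// mulr_ge0 ?powR_ge0// invr_ge0 ltW.
rewrite big_nat_recr//= -(ler_pM2l b0) mulrDr.
rewrite !mulrA mulfV ?gt_eqF// mul1r.
apply: le_trans (powR_increment n a01); rewrite lerD2r.
by rewrite -ler_pdivlMl.
Qed.

(** Subtraction is truncated, so all [k <= j] contribute [g 0 = 0]; the remaining differences are
    distinct and lie between 1 and [n]. *)
Lemma sum_shift_le (R : numDomainType) (g : nat -> R) (n j : nat) :
  (forall m, 0 <= g m) -> g 0%N = 0 -> (j < n)%N ->
  \sum_(0 <= k < n) g (k - j)%N <= \sum_(1 <= m < n.+1) g m.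
Proof.
move=> g0 g00 jn; rewrite (big_cat_nat _ (n := j))//=; last exact: ltnW.
rewrite big_nat big1 ?add0r; last first.
  by move=> k /andP[_ kj]; rewrite (eqP (ltnW kj)).
rewrite -{1}[j]add0n big_addn.
under eq_bigr do rewrite addnK.
rewrite (@big_ltn _ _ _ 0)// ?subn_gt0// g00 add0r.
rewrite [leRHS](big_cat_nat _ (n := (n - j)%N))//= ?subn_gt0//; last first.
  by rewrite (leq_trans (leq_subr _ _)).
by rewrite lerDl sumr_ge0.
Qed.

(** * The Fejer kernel *)

Section fejer.
Variable R : realType.
Implicit Types (n : nat) (u : R).

Definition fejer n u : R :=
  \sum_(0 <= j < n) \sum_(0 <= k < n) cos ((j%:R - k%:R) * u).

(** The kernel is unnormalised: it is the squared modulus of the sum of [e^(i j u)] over [j < n],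
    which gives both its positivity and its size near 0. *)
Lemma fejerE n u : fejer n u =
  (\sum_(0 <= j < n) cos (j%:R * u)) ^+ 2
  + (\sum_(0 <= j < n) sin (j%:R * u)) ^+ 2.
Proof.
rewrite !expr2 !mulr_suml -big_split/=; apply: eq_bigr => j _.
rewrite !mulr_sumr -big_split/=; apply: eq_bigr => k _.
by rewrite mulrBl cosB.
Qed.

Lemma fejer_ge0 n u : 0 <= fejer n u.
Proof. by rewrite fejerE addr_ge0 ?sqr_ge0. Qed.

(** For [u >= 0] the mean value theorem gives [cos u >= 1 - u]; evenness does the rest. *)
Lemma cos_ge_half u : `|u| <= 2^-1 -> 2^-1 <= cos u.
Proof.
wlog u0 : u / 0 <= u => [H|].
  have [|u0] := leP 0 u; first exact: H.
  by rewrite -normrN -cosN => ?; apply: H => //; rewrite oppr_ge0 ltW.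
rewrite ger0_norm// => u1.
have [c _] := @MVT_segment R cos (fun x => - sin x) 0 u u0
   (fun x _ => is_derive_cos x) (continuous_subspaceT (@continuous_cos R)).
rewrite cos0 subr0 => h; have := sin_le1 c; nra.
Qed.

(** The sine square is dropped, and all angles [j u] with [j < n] stay where the cosine is at least
    one half. *)
Lemma fejer_ge n u : n%:R * `|u| <= 2^-1 -> (n%:R / 2) ^+ 2 <= fejer n u.
Proof.
move=> nu; rewrite fejerE ler_wpDr ?sqr_ge0//.
have H : n%:R / 2 <= \sum_(0 <= j < n) cos (j%:R * u).
  rewrite mulr_natl -[X in _ *+ X]subn0 -sumr_const_nat.
  apply: ler_sum_nat => j /andP[_ jn]; apply: cos_ge_half.
  by rewrite normrM normr_nat (le_trans _ nu)// ler_wpM2r// ler_nat ltnW.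
by rewrite lerXn2r ?nnegrE// (le_trans _ H).
Qed.

End fejer.

Lemma dotpZr (R : realType) (x xi : R * R) (t : R) : dotp x (t *: xi) = t * dotp x xi.
Proof. by rewrite /dotp /= /GRing.scale /=; ring. Qed.

Lemma dotpBl (R : realType) (x y xi : R * R) : dotp (y - x) xi = dotp y xi - dotp x xi.
Proof. by rewrite /dotp /=; ring. Qed.

Lemma enormZ (R : realType) (t : R) (xi : R * R) : enorm (t *: xi) = `|t| * enorm xi.
Proof.
rewrite /enorm -sqrtr_sqr -sqrtrM ?sqr_ge0//; congr Num.sqrt.
by rewrite /dotp /= /GRing.scale /=; ring.
Qed.

(** * Mass of thin strips under Fourier decay *)

Section strip.
Variables (R : realType) (eta : {finite_measure set (R * R)%type -> \bar R}).

Lemma Rintegral_sum_nat (f : nat -> R * R -> R) (n : nat) :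
  (forall k, eta.-integrable setT (EFin \o f k)) ->
  eta.-integrable setT (EFin \o (fun x => \sum_(0 <= k < n) f k x)) /\
  \int[eta]_x (\sum_(0 <= k < n) f k x) = \sum_(0 <= k < n) \int[eta]_x f k x.
Proof.
move=> fi; elim: n => [|n [IH1 IH2]].
  split.
    apply: (@bounded_measurable_integrable _ _ 0) => [|x].
      by under eq_fun do rewrite big_geq//; exact: measurable_cst.
    by rewrite big_geq// normr0.
  by rewrite big_geq//; under eq_Rintegral do rewrite big_geq//; rewrite Rintegral_cst// mul0r.
have -> : (fun x => \sum_(0 <= k < n.+1) f k x) =
          (fun x => \sum_(0 <= k < n) f k x + f n x).
  by apply/funext => x; rewrite big_nat_recr.
split; first exact: (integrableD measurableT IH1 (fi n)).
by rewrite RintegralD// IH2 big_nat_recr.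
Qed.

Lemma measurable_fun_shifted (x xi : R * R) (c : R) :
  measurable_fun [set: R * R] (fun y : R * R => c * dotp (y - x) xi).
Proof.
apply: measurable_funM => //; under eq_fun do rewrite dotpBl.
by apply: measurable_funB => //; exact: measurable_dotp.
Qed.

Lemma measurable_strip (x xi : R * R) (r : R) :
  measurable [set y : R * R | `|dotp (y - x) xi| <= r].
Proof.
have m : measurable_fun [set: R * R] (fun y : R * R => `|dotp (y - x) xi|).
  apply: measurableT_comp => //.
  by have := @measurable_fun_shifted x xi 1; under eq_fun do rewrite mul1r.
have := m measurableT _ (measurable_itv `]-oo, r]).
by rewrite setTI; congr measurable; apply/seteqP; split => y /=; rewrite in_itv.
Qed.

(** Centring at [x] only changes the phase: the cosine of a difference splits into the real and
    imaginary parts of the transform with coefficients of modulus at most 1, whence the factor 2. *)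
Lemma Rintegral_cos_shift (x xi : R * R) (t : R) :
  `|\int[eta]_y cos (t * (2 * pi * dotp (y - x) xi))|
    <= 2 * complex.Re `|fourier eta (t *: xi)|.
Proof.
pose A (y : R * R) := - 2 * pi * dotp y (t *: xi).
have mA : measurable_fun setT A by apply: measurable_funM => //; exact: measurable_dotp.
have -> : \int[eta]_y cos (t * (2 * pi * dotp (y - x) xi)) =
  cos (A x) * \int[eta]_y cos (A y) + sin (A x) * \int[eta]_y sin (A y).
  rewrite -!RintegralZl//; [|exact: integrable_sin|exact: integrable_cos].
  rewrite -RintegralD//.
  - apply: eq_Rintegral => y _.
    rewrite -cosN (_ : - _ = A y - A x); first by rewrite cosB mulrC (mulrC (sin _)).
    by rewrite /A !dotpZr dotpBl; ring.
  - apply: (@bounded_measurable_integrable _ _ 1) => [|y].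
      apply: measurable_funM => //; apply: measurableT_comp => //.
      by apply: continuous_measurable_fun; exact: continuous_cos.
    by rewrite normrM mulr_ile1// cos_max.
  - apply: (@bounded_measurable_integrable _ _ 1) => [|y].
      apply: measurable_funM => //; apply: measurableT_comp => //.
      by apply: continuous_measurable_fun; exact: continuous_sin.
    by rewrite normrM mulr_ile1// sin_max.
have le1 (u v : R) : `|u| <= Num.sqrt (u ^+ 2 + v ^+ 2).
  by rewrite -sqrtr_sqr ler_wsqrtr// lerDl sqr_ge0.
rewrite Re_normc /=; set S := Num.sqrt _.
have h1 : `|\int[eta]_y cos (A y)| <= S by exact: le1.
have h2 : `|\int[eta]_y sin (A y)| <= S by rewrite /S addrC; exact: le1.
rewrite (le_trans (ler_normD _ _))// mulr2n mulrDl mul1r lerD// normrM.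
  by rewrite (le_trans _ h1)// ler_piMl// cos_max.
by rewrite (le_trans _ h2)// ler_piMl// sin_max.
Qed.

Lemma integrable_cos_shift (x xi : R * R) (t : R) :
  eta.-integrable setT (EFin \o (fun y : R * R => cos (t * (2 * pi * dotp (y - x) xi)))).
Proof.
apply: integrable_cos; apply: measurable_funM => //.
exact: measurable_fun_shifted.
Qed.

Lemma Rintegral_fejer (x xi : R * R) (n : nat) :
  eta.-integrable setT (EFin \o (fun y : R * R => fejer n (2 * pi * dotp (y - x) xi))) /\
  \int[eta]_y fejer n (2 * pi * dotp (y - x) xi) =
  \sum_(0 <= j < n) \sum_(0 <= k < n)
     \int[eta]_y cos ((j%:R - k%:R) * (2 * pi * dotp (y - x) xi)).
Proof.
have I j k := @integrable_cos_shift x xi (j%:R - k%:R).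
have [J1 J2] := Rintegral_sum_nat n (fun j => (Rintegral_sum_nat n (I j)).1).
split=> //; rewrite J2; apply: eq_bigr => j _.
exact: (Rintegral_sum_nat n (I j)).2.
Qed.

(** The [n] diagonal terms contribute the mass [T] each. Off the diagonal only one of the truncated
    differences [k - j] and [j - k] is nonzero, so a single formula serves both orders. The 4 is the
    2 of [Rintegral_cos_shift] times these two orders. *)
Lemma Rintegral_fejer_le (x xi : R * R) (n : nat) (g : nat -> R) :
  (forall m, 0 <= g m) -> g 0%N = 0 ->
  (forall t m, `|t| = m.+1%:R -> complex.Re `|fourier eta (t *: xi)| <= g m.+1) ->
  \int[eta]_y fejer n (2 * pi * dotp (y - x) xi) <=
    n%:R * (fine (eta setT) + 4 * \sum_(1 <= m < n.+1) g m).
Proof.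
move=> g0 g00 Fg; rewrite (Rintegral_fejer x xi n).2.
set T := fine _; set G := \sum_(1 <= m < n.+1) g m.
have T0 : 0 <= T by exact: fine_ge0.
pose D (j k : nat) : R := if k == j then T else 0.
have term (j k : nat) :
    \int[eta]_y cos ((j%:R - k%:R) * (2 * pi * dotp (y - x) xi)) <=
    D j k + (2 * g (k - j)%N + 2 * g (j - k)%N).
  rewrite (le_trans (ler_norm _))// /D; case: eqVneq => [->|kj].
    rewrite subnn g00 mulr0 !addr0 subrr.
    apply: le_Rintegral_mass => [|y]; last exact: cos_max.
    by under eq_fun do rewrite mul0r; exact: measurable_cst.
  rewrite add0r (le_trans (Rintegral_cos_shift _ _ _))// -mulrDr ler_pM2l//.
  have [jk|jk|/eqP] := ltngtP j k; last by rewrite eq_sym (negbTE kj).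
    have E : (k - j)%N = (k - j).-1.+1 by rewrite prednK// subn_gt0.
    rewrite (eqP (ltnW jk)) g00 addr0 E; apply: Fg.
    by rewrite -E distrC natrB ?ger0_norm ?subr_ge0 ?ler_nat// ltnW.
  have E : (j - k)%N = (j - k).-1.+1 by rewrite prednK// subn_gt0.
  rewrite (eqP (ltnW jk)) g00 add0r E; apply: Fg.
  by rewrite -E natrB ?ger0_norm ?subr_ge0 ?ler_nat// ltnW.
have sumC (c : R) : \sum_(0 <= j < n) c = n%:R * c.
  by rewrite sumr_const_nat subn0 mulr_natl.
have S1 : \sum_(0 <= j < n) \sum_(0 <= k < n) D j k <= n%:R * T.
  rewrite -sumC; apply: ler_sum_nat => j /andP[_ jn].
  by rewrite /D -big_mkcond big_nat1_eq jn.
have S2 : \sum_(0 <= j < n) \sum_(0 <= k < n) g (k - j)%N <= n%:R * G.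
  by rewrite -sumC; apply: ler_sum_nat => j /andP[_ jn]; exact: sum_shift_le.
have S3 : \sum_(0 <= j < n) \sum_(0 <= k < n) g (j - k)%N <= n%:R * G.
  by rewrite exchange_big_nat.
apply: (@le_trans _ _ (\sum_(0 <= j < n) \sum_(0 <= k < n)
    (D j k + (2 * g (k - j)%N + 2 * g (j - k)%N)))).
  by apply: ler_sum => j _; apply: ler_sum => k _; exact: term.
under eq_bigr do rewrite big_split /= big_split /= -!mulr_sumr.
rewrite big_split /= big_split /= -!mulr_sumr.
lra.
Qed.

(** A Chebyshev bound: the kernel is at least [(n / 2) ^ 2] on the strip and nonnegative off it. *)
Lemma measure_strip_le_fejer (x xi : R * R) (r : R) (n : nat) :
  n%:R * (2 * pi * r) <= 2^-1 ->
  (n%:R / 2) ^+ 2 * fine (eta [set y | `|dotp (y - x) xi| <= r]) <=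
  \int[eta]_y fejer n (2 * pi * dotp (y - x) xi).
Proof.
move=> nr; set S := [set y | _]; have mS : measurable S by exact: measurable_strip.
rewrite -Rintegral_cst// Rintegral_mkcond; apply: le_Rintegral => //.
- apply: (@bounded_measurable_integrable _ _ ((n%:R / 2) ^+ 2)) => [|y].
    by apply/(measurable_restrictT _ mS).
  by rewrite /patch; case: ifP => _; rewrite ?normr0 ?sqr_ge0// ger0_norm ?sqr_ge0.
- exact: (Rintegral_fejer x xi n).1.
move=> y _; rewrite /patch; case: ifPn => [|_]; last exact: fejer_ge0.
rewrite inE => Sy; apply: fejer_ge; rewrite (le_trans _ nr)// ler_wpM2l//.
have pi20 : 0 <= 2 * pi :> R by rewrite mulr_ge0 ?pi_ge0.
by rewrite normrM (ger0_norm pi20) ler_wpM2l.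
Qed.

(** The constant is uniform in the centre and in the unit direction; [s < 2] makes [a < 1], as the
    estimate of the power sum requires. *)
Lemma strip_measure_le (s : R) : 0 <= s < 2 -> fourier_decay eta s ->
  exists2 C, 0 < C & forall x xi r, enorm xi = 1 -> 0 < r <= (4 * pi)^-1 ->
    fine (eta [set y | `|dotp (y - x) xi| <= r]) <= C * r `^ (s / 2).
Proof.
move=> /andP[s0 s2] /(fourier_decay_bound s0)[C0 C00 FC].
set a := s / 2.
have a0 : 0 <= a by rewrite divr_ge0.
have a1 : a < 1 by rewrite ltr_pdivrMr// mul1r.
have b0 : 0 < 1 - a by rewrite subr_gt0.
set T := fine (eta setT); have T0 : 0 <= T by exact: fine_ge0.
pose L := 4 * (C0 * (1 - a)^-1).
have L0 : 0 <= L by rewrite !mulr_ge0// invr_ge0 ltW.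
have p8 : 0 < 8 * pi :> R by rewrite mulr_gt0 ?pi_gt0.
(* The 4 inverts the [1/4] of the kernel bound, [8 * pi] comes from [n >= (8 pi r)^-1], and the
   [+ 1] makes the constant positive. *)
exists (4 * (T + L + 1) * (8 * pi) `^ a).
  by rewrite !mulr_gt0 ?powR_gt0// ltr_wpDl ?addr_ge0.
move=> x xi r xi1 /andP[r0 r1].
have pr : 0 < 4 * pi * r by rewrite !mulr_gt0 ?pi_gt0.
(* [X] is the largest order allowed by [measure_strip_le_fejer]. Since [X >= 1], truncation loses at
   most a factor 2. *)
pose X : R := (4 * pi * r)^-1.
have X1 : 1 <= X.
  by rewrite invf_ge1// -ler_pdivlMl ?mulr1// mulr_gt0 ?pi_gt0.
pose n := Num.trunc X.
have n1 : (0 < n)%N by rewrite /n Num.Theory.truncn_gt0.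
have nX : n%:R <= X by rewrite Num.Theory.truncn_le (le_trans _ X1).
have Xn : X / 2 <= n%:R.
  have := Num.Theory.truncnS_gt X; rewrite -/n -natr1.
  have : 1 <= n%:R :> R by rewrite ler1n.
  lra.
have n0 : 0 < n%:R :> R by rewrite ltr0n.
(* The value at 0 is forced to 0 because the diagonal is already counted by the mass. *)
pose g m : R := if m is 0%N then 0 else C0 * m%:R `^ (- a).
have g0 m : 0 <= g m by case: m => //= m; rewrite mulr_ge0 ?powR_ge0.
have Fg t m : `|t| = m.+1%:R -> complex.Re `|fourier eta (t *: xi)| <= g m.+1.
  by move=> tm; have := FC (t *: xi); rewrite enormZ xi1 tm mulr1; apply.
have nr : n%:R * (2 * pi * r) <= 2^-1.
  have -> : 2^-1 = X * (2 * pi * r).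
    by have : X * (4 * pi * r) = 1 by [rewrite mulVf// gt_eqF]; lra.
  by rewrite ler_wpM2r// !mulr_ge0 ?pi_ge0// ltW.
have := le_trans (measure_strip_le_fejer x xi nr)
  (Rintegral_fejer_le x n g0 erefl Fg).
rewrite -/T; set E := fine _; set G := \sum_(_ <= _ < _) _ => H.
have GL : 4 * G <= L * n%:R `^ (1 - a).
  have -> : G = C0 * \sum_(1 <= m < n.+1) m%:R `^ (- a).
    by rewrite /G mulr_sumr; apply: eq_big_nat => -[].
  rewrite /L -!mulrA ler_pM2l// ler_wpM2l//.
  by apply: sum_powRN_le; rewrite a0.
set Q := n%:R `^ (- a).
have P : n%:R `^ (1 - a) = n%:R * Q.
  by rewrite /Q powRD ?(gt_eqF n0) ?implybT// powRr1.
have P1 : 1 <= n%:R * Q.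
  by rewrite -P -[leLHS](powRr0 n%:R) ler_powR ?ler1n// ltW.
have EQ : E <= 4 * (T + L + 1) * Q.
  rewrite -(ler_pM2l n0) -(ler_pM2l n0).
  rewrite P in GL.
  (* The mass term is absorbed using [1 <= n Q]. *)
  have : n%:R * (T + 4 * G) <= n%:R * ((T + L + 1) * (n%:R * Q)).
    rewrite ler_pM2l//; nra.
  by move: H; lra.
apply: le_trans EQ _; rewrite -[leRHS]mulrA ler_wpM2l//.
  by rewrite !mulr_ge0// !addr_ge0.
have XE : X / 2 = (8 * pi * r)^-1 by rewrite /X -invfM; congr _^-1; ring.
have pr8 : 0 <= 8 * pi * r by rewrite mulr_ge0// ltW.
have X20 : 0 < X / 2 by rewrite XE invr_gt0 mulr_gt0.
have -> : (8 * pi) `^ a * r `^ a = (X / 2) `^ (- a).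
  by rewrite XE -powR_inv1// -powRrM mulrNN mul1r -powRM// ltW.
rewrite /Q !powRN lef_pV2 ?posrE ?powR_gt0//.
by rewrite ge0_ler_powR ?nnegrE// ltW.
Qed.

End strip.

(** * Local geometry of a regular Jordan curve *)

Section plane_geometry.
Variable R : realType.
Implicit Types (x y v w : R * R) (gamma : R -> R * R).

Lemma continuous_dotp w : continuous (fun y => dotp y w).
Proof.
move=> y; apply: cvgD; apply: cvgMr_tmp.
  exact: cvg_fst.
exact: cvg_snd.
Qed.

Lemma continuous_dotp_self x : continuous (fun y => dotp (y - x) (y - x)).
Proof.
have c1 : continuous (fun y : R * R => (y - x).1).
  by move=> y; apply: cvgB; [exact: cvg_fst|exact: cvg_cst].
have c2 : continuous (fun y : R * R => (y - x).2).
  by move=> y; apply: cvgB; [exact: cvg_snd|exact: cvg_cst].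
by move=> y; apply: cvgD; apply: cvgM; [exact: c1|exact: c1|exact: c2|exact: c2].
Qed.

Lemma continuous_enorm x : continuous (fun y => enorm (y - x)).
Proof.
move=> y; apply: (@continuous_comp _ _ _ (fun y => dotp (y - x) (y - x)) Num.sqrt).
  exact: continuous_dotp_self.
exact: sqrt_continuous.
Qed.

Lemma open_eball x (r : R) : open (eball x r).
Proof.
have := (continuousP _).1 (@continuous_enorm x) _ (@open_lt R r).
by [].
Qed.

Lemma dotp_self_ge0 y : 0 <= dotp y y.
Proof. by rewrite addr_ge0 ?sqr_ge0. Qed.

Lemma sqr_enorm y : enorm y ^+ 2 = dotp y y.
Proof. by rewrite sqr_sqrtr ?dotp_self_ge0. Qed.

Lemma enorm_gt0 y : (0 < enorm y) = (y != 0).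
Proof.
rewrite /enorm sqrtr_gt0 lt0r dotp_self_ge0 andbT; congr (~~ _).
case: y => y1 y2; rewrite /dotp /= -!expr2 paddr_eq0 ?sqr_ge0// !sqrf_eq0.
by [].
Qed.

Lemma normr_dotp_le y w : `|dotp y w| <= enorm y * enorm w.
Proof.
rewrite -(ler_pXn2r (n := 2))// ?nnegrE ?mulr_ge0 ?sqrtr_ge0//.
rewrite real_normK ?num_real// exprMn !sqr_enorm /dotp.
have := sqr_ge0 (y.1 * w.2 - y.2 * w.1); nra.
Qed.

(** A continuous linear functional passes through the limit of difference quotients; this reduces
    the plane curve to its scalar components. *)
Lemma is_derive_dotp gamma w (t : R) : derivable gamma t 1 ->
  is_derive t 1 (fun s => dotp (gamma s) w) (dotp (derive1 gamma t) w).
Proof.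
move=> dg.
have H : (fun h : R => h^-1 *: (dotp (gamma (h *: 1 + t)) w - dotp (gamma t) w)) @ 0^'
    --> dotp (derive1 gamma t) w.
  rewrite derive1E.
  have C := continuous_cvg _ (@continuous_dotp w ('D_1 gamma t)) dg.
  have -> : (fun h : R => h^-1 *: (dotp (gamma (h *: 1 + t)) w - dotp (gamma t) w)) =
      (fun y => dotp y w) \o (fun h : R => h^-1 *: (gamma (h *: 1 + t) - gamma t)).
    apply/funext => h /=.
    by rewrite -dotpBl /dotp /= /GRing.scale /=; ring.
  exact: C.
apply: DeriveDef; first by apply/cvg_ex; eexists; exact: H.
exact: cvg_lim H.
Qed.

Lemma is_derive_near (f : R -> R) (t L e : R) : is_derive t 1 f L -> 0 < e ->
  exists2 d : R, 0 < d & forall s, `|s - t| < d ->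
    `|f s - f t - L * (s - t)| <= e * `|s - t|.
Proof.
move=> [df Df] e0.
have : (fun h : R => h^-1 *: (f (h *: 1 + t) - f t)) @ 0^' --> L by rewrite -Df.
move=> /cvgrPdist_le /(_ _ e0) [/= d d0 H].
exists d => // s st; have [->|st0] := eqVneq s t.
  by rewrite !subrr mulr0 subrr normr0 mulr0.
have /= := H (s - t); rewrite sub0r normrN subr_eq0 => /(_ st st0).
rewrite /GRing.scale /= mulr1 subrK.
have nz : 0 < `|s - t| by rewrite normr_gt0 subr_eq0.
rewrite -(ler_pM2r nz) -normrM; congr (_ <= _).
rewrite -normrN; congr `|_|; field; by rewrite subr_eq0.
Qed.

Lemma one_periodic_int gamma (t : R) (k : int) :
  one_periodic gamma -> gamma (t + k%:~R) = gamma t.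
Proof.
move=> per.
have pn (n : nat) s : gamma (s + n%:R) = gamma s.
  by elim: n => [|n IH]; rewrite ?addr0// -natr1 addrA per.
case: k => n; first exact: pn.
by rewrite NegzE mulrNz -[in RHS](subrK n.+1%:R t) pn.
Qed.


Lemma derivable_continuous_dotp gamma w :
  (forall t, derivable gamma t 1) -> continuous (fun t => dotp (gamma t) w).
Proof.
move=> dg t; apply: differentiable_continuous; apply/derivable1_diffP.
by have [] := is_derive_dotp w (dg t).
Qed.

Lemma derivable_continuous_plane gamma :
  (forall t, derivable gamma t 1) -> continuous gamma.
Proof. by move=> dg t; apply: differentiable_continuous; exact/derivable1_diffP. Qed.

Lemma regular_curve_neq0 gamma t : regular_curve gamma -> derive1 gamma t != 0.
Proof.
move=> reg; rewrite -enorm_gt0; apply: lt_le_trans reg _; apply: ge_inf.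
  by exists 0 => _ [s _ <-]; exact: sqrtr_ge0.
by exists t.
Qed.

(** By periodicity the range is the image of the compact interval from 0 to 1. Closedness makes its
    complement measurable and places the support of the measure on the curve. *)
Lemma closed_range_periodic gamma :
  one_periodic gamma -> continuous gamma -> closed (range gamma).
Proof.
move=> per cg.
have -> : range gamma = gamma @` `[0, 1].
  apply/seteqP; split => [_ [t _ <-]|_ [t _ <-]]; last by exists t.
  exists (t - (Num.floor t)%:~R).
    rewrite /= in_itv/= subr_ge0 Num.Theory.floor_le.
    by have := Num.Theory.lt_succ_floor t; rewrite intrD; lra.
  by rewrite -mulrNz one_periodic_int.
apply: compact_closed; first exact: norm_hausdorff.
by apply: continuous_compact; [exact: continuous_subspaceT|exact: segment_compact].
Qed.

(* Outside the period translates of a neighbourhood of [t0], compactness and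
   injectivity keep the curve at a positive distance from [gamma t0]. *)
Lemma curve_ball_near gamma (t0 d : R) :
  one_periodic gamma -> continuous gamma -> injective_mod1 gamma -> 0 < d ->
  exists2 r0 : R, 0 < r0 & forall t, enorm (gamma t - gamma t0) < r0 ->
    exists2 s, `|s - t0| < d & gamma s = gamma t.
Proof.
(* The window from [t0 + e] to [t0 + 1 - e] is a period with a neighbourhood of [t0] removed; the
   bound [4^-1] keeps it nonempty. *)
move=> per cg inj d0; pose e := Num.min (d / 2) 4^-1.
have e0 : 0 < e by rewrite lt_min divr_gt0//= invr_gt0.
have e4 : e <= 4^-1 by rewrite ge_min lexx orbT.
have ed : e < d by rewrite gt_min ltr_pdivrMr// ltr_pMr// ltr1n.
have le1 : t0 + e <= t0 + 1 - e by lra.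
have cq : continuous (fun t => enorm (gamma t - gamma t0)).
  move=> t; apply: (@continuous_comp _ _ _ gamma (fun y => enorm (y - gamma t0))).
    exact: cg.
  exact: continuous_enorm.
have [c] := EVT_min le1 (continuous_subspaceT cq).
rewrite in_itv/= => /andP[c1 c2] cmin.
exists (enorm (gamma c - gamma t0)).
  (* A zero minimum would make [c - t0] an integer strictly between 0 and 1. *)
  rewrite enorm_gt0 subr_eq0; apply/eqP => /inj[k] ck.
  have : 0 < k%:~R :> R by rewrite -ck; lra.
  have : k%:~R < 1%:~R :> R by rewrite -ck; lra.
  by rewrite ltr0z ltr_int gtz0_ge1 ltNge => /negbTE ->.
(* The representative of [t] between [t0 - e] and [t0 + 1 - e]: either it is close to [t0], or it
   lies in the window, against the minimality at [c]. *)
move=> t tc; pose s := t - (Num.floor (t - t0 + e))%:~R.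
have gs : gamma s = gamma t by rewrite /s -mulrNz one_periodic_int.
exists s => //; have [s1 s2] : t0 - e <= s /\ s < t0 + 1 - e.
  have := Num.Theory.lt_succ_floor (t - t0 + e).
  have := Num.Theory.floor_le (t - t0 + e).
  by rewrite intrD /s; lra.
have [ts|st] := leP (t0 + e) s; last by rewrite ltr_norml; lra.
have := cmin s; rewrite in_itv/= ts ltW// gs => /(_ isT).
by rewrite leNgt tc.
Qed.

Lemma normr_le_slope (F L h k : R) :
  `|F - L * h| <= `|h| -> `|h| <= `|k| -> `|F| <= (`|L| + 1) * `|k|.
Proof.
move=> Fh hk; apply: le_trans (ler_wpM2l _ hk); last by rewrite addr_ge0.
rewrite mulrDl mul1r -normrM -[F in leLHS](subrK (L * h)) addrC.
by rewrite (le_trans (ler_normD _ _))// lerD.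
Qed.

(** The tangential component controls the parameter, [|s - t0| = O(r)]. The normal component has
    zero derivative at [t0], and this derivative grows at most linearly since [gamma'] is
    differentiable there; the mean value theorem then makes the component [O(r^2)]. *)
Lemma curve_ball_strip gamma (t0 : R) :
  C2_Jordan_curve gamma -> regular_curve gamma ->
  exists xi K r0, [/\ enorm xi = 1, 0 < K, 0 < r0 & forall r t, 0 < r < r0 ->
    enorm (gamma t - gamma t0) < r ->
    `|dotp (gamma t - gamma t0) xi| <= K * r ^+ 2].
Proof.
move=> [per [dg ddg _] inj] reg.
have cg := derivable_continuous_plane dg.
pose v := derive1 gamma t0; pose V := enorm v.
have V0 : 0 < V by rewrite /V enorm_gt0 regular_curve_neq0.
(* The unit tangent rotated by a right angle. *)
pose xi : R * R := V^-1 *: ((- v.2, v.1) : R * R).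
have xi1 : enorm xi = 1.
  rewrite enormZ gtr0_norm ?invr_gt0// /enorm /dotp /= mulrNN addrC.
  by rewrite -/(dotp v v) -/(enorm v) mulVf// gt_eqF.
have vxi : dotp (derive1 gamma t0) xi = 0.
  by rewrite dotpZr /dotp /= -/v; ring.
(* With an error of half the slope [dotp v v = V ^+ 2], the tangential component stays at least
   [V ^+ 2 / 2 * |s - t0|]. *)
have V2 : 0 < V ^+ 2 / 2 by rewrite divr_gt0// exprn_gt0.
have [d1 d10 H1] := is_derive_near (is_derive_dotp v (dg t0)) V2.
have [L dL] : exists L, is_derive t0 1 (fun c => dotp (derive1 gamma c) xi) L.
  by eexists; exact: is_derive_dotp (ddg t0).
have [d2 d20 H2] := is_derive_near dL ltr01.
pose K := `|L| + 1.
have K0 : 0 < K by rewrite ltr_wpDl.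
pose d := Num.min d1 d2.
have d0 : 0 < d by rewrite lt_min d10.
have [r0 r00 H0] := curve_ball_near t0 per cg inj d0.
exists xi, (K * (2 / V) ^+ 2), r0; split => //.
  by rewrite mulr_gt0// exprn_gt0// divr_gt0.
move=> r t /andP[rpos rr0] tr.
have [s sd gs] := H0 t (lt_trans tr rr0); rewrite -gs in tr *.
move: sd; rewrite lt_min => /andP[sd1 sd2].
have sr : `|s - t0| <= 2 / V * r.
  have := H1 s sd1; rewrite -dotpBl -/v -sqr_enorm -/V => h1.
  have h2 := normr_dotp_le (gamma s - gamma t0) v.
  have : V ^+ 2 / 2 * `|s - t0| <= V * r.
    apply: (@le_trans _ _ (enorm (gamma s - gamma t0) * V)); last first.
      by rewrite mulrC ler_pM2l// ltW.
    apply: le_trans h2.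
    have : `|V ^+ 2 * (s - t0)| = V ^+ 2 * `|s - t0|.
      by rewrite normrM ger0_norm// sqr_ge0.
    have := ler_normB (dotp (gamma s - gamma t0) v)
      (dotp (gamma s - gamma t0) v - V ^+ 2 * (s - t0)).
    by rewrite opprB addrCA subrr addr0; lra.
  rewrite -[_ <= 2 / V * r](ler_pM2l V2).
  by rewrite (_ : V ^+ 2 / 2 * (2 / V * r) = V * r)//; field; rewrite gt_eqF.
have slope c : `|c - t0| <= `|s - t0| ->
    `|dotp (derive1 gamma c) xi| <= K * `|s - t0|.
  move=> cs; have := H2 c (le_lt_trans cs sd2).
  by rewrite vxi subr0 mul1r => /normr_le_slope; apply.
have mvt : `|dotp (gamma s - gamma t0) xi| <= K * `|s - t0| ^+ 2.
  rewrite dotpBl expr2 mulrA.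
  have dF c := is_derive_dotp xi (dg c).
  have cF := @derivable_continuous_dotp gamma xi dg.
  have [st|st] := leP s t0.
    have [c] := MVT_segment st (fun c _ => dF c) (continuous_subspaceT cF).
    rewrite in_itv/= => /andP[c1 c2] E.
    rewrite distrC E normrM [X in _ * X]distrC ler_wpM2r// slope//.
    by rewrite !ler0_norm ?subr_le0// lerN2 lerD2r.
  have [c] := MVT_segment (ltW st) (fun c _ => dF c) (continuous_subspaceT cF).
  rewrite in_itv/= => /andP[c1 c2] E.
  rewrite E normrM ler_wpM2r// slope//.
  by rewrite !ger0_norm ?subr_ge0 ?(ltW st)// lerD2r.
apply: le_trans mvt _; rewrite -mulrA ler_pM2l// -exprMn.
by rewrite lerXn2r ?nnegrE// mulr_ge0// ?ltW// divr_gt0.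
Qed.

End plane_geometry.

(** * From ball estimates to dimensions *)

Section local_dimension.
Variables (R : realType) (eta : {finite_measure set (R * R)%type -> \bar R}).

Lemma spt_subset (F : set (R * R)) :
  closed F -> eta (~` F) = 0%E -> spt eta `<=` F.
Proof.
move=> cF F0 x sx; apply: contrapT => nFx.
by have := sx _ (closed_openC cF) nFx; rewrite F0 ltxx.
Qed.

Lemma measurable_eball (x : R * R) (r : R) : measurable (eball x r).
Proof. by apply: open_measurable_plane; exact: open_eball. Qed.

Lemma spt_eball_gt0 (x : R * R) (r : R) :
  spt eta x -> 0 < r -> 0 < fine (eta (eball x r)).
Proof.
move=> sx r0; apply: fine_gt0; apply/andP; split.
  apply: sx; first exact: open_eball.
  by rewrite /eball /= subrr /enorm /dotp /= !mulr0 addr0 sqrtr0.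
by rewrite ltey_eq fin_num_measure//; exact: measurable_eball.
Qed.

(** Taking logarithms and dividing by [ln r < 0] gives a quotient at least [s + ln C / ln r], whose
    last term tends to 0. Membership in the support makes the ball mass positive, so that its
    logarithm can be compared. *)
Lemma lower_local_dim_ge (x : R * R) (C r0 s : R) :
  spt eta x -> 0 < C -> 0 < r0 ->
  (forall r, 0 < r < r0 -> fine (eta (eball x r)) <= C * r `^ s) ->
  (s%:E <= lower_local_dim eta x)%E.
Proof.
move=> sx C0 r00 H; apply/lee_subgt0Pr => e e0.
rewrite /lower_local_dim limf_einfE.
(* The bound 1 makes [ln r] negative; the exponential makes the error [ln C / ln r] at least
   [- e]. *)
pose d := Num.min r0 (Num.min 1 (expR (- (`|ln C| / e)))).
have d0 : 0 < d by rewrite !lt_min r00 ltr01 expR_gt0.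
apply: (@le_trans _ _ (ereal_inf ((fun rho : R =>
    (log2 (fine (eta (eball x rho))) / log2 rho)%:E) @` [set r | 0 < r < d]))); last first.
  apply: ereal_sup_ubound; exists [set r | 0 < r < d] => //.
  by apply: filterS2 (nbhs_right_gt 0) (nbhs_right_lt d0) => r r0' rd; apply/andP.
apply: le_ereal_inf_tmp => _ [r /andP[rpos rd] <-].
move: rd; rewrite !lt_min => /and3P[rr0 r1 re].
rewrite -EFinB lee_fin.
have m0 := spt_eball_gt0 sx rpos.
have lr : ln r < 0 by rewrite ln_lt0// rpos.
have l2 : 0 < ln 2 :> R by rewrite ln_gt0// ltr1n.
rewrite /log2 invfM invrK mulrACA mulVf ?gt_eqF// mulr1.
rewrite ler_ndivlMr//.
have rs0 : 0 < r `^ s by rewrite powR_gt0.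
have : ln (fine (eta (eball x r))) <= ln C + s * ln r.
  rewrite -ln_powR -lnM ?posrE// ler_ln ?posrE ?mulr_gt0//.
  by apply: H; rewrite rpos.
have : ln C <= - (e * ln r).
  have : ln r < - (`|ln C| / e).
    by rewrite -[ltRHS]expRK ltr_ln ?posrE ?expR_gt0.
  rewrite ltrNr ltr_pdivrMr// => h.
  apply: le_trans (ler_norm _) _; lra.
lra.
Qed.

(** Up to the null complement of the curve, the ball lies in a strip of half-width [K r^2], and
    [(K r^2)^(s/2) = K^(s/2) r^s]. *)
Lemma curve_eball_measure_le (gamma : R -> R * R) (s t0 : R) :
  C2_Jordan_curve gamma -> regular_curve gamma -> eta (~` range gamma) = 0%E ->
  0 <= s < 2 -> fourier_decay eta s ->
  exists C r0, [/\ 0 < C, 0 < r0 & forall r, 0 < r < r0 ->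
    fine (eta (eball (gamma t0) r)) <= C * r `^ s].
Proof.
move=> J reg G0 s02 dec.
have [per [dg _ _] _] := J.
have clG := closed_range_periodic per (derivable_continuous_plane dg).
have [xi [K [r0 [xi1 K0 r00 Kr]]]] := curve_ball_strip t0 J reg.
have [C C0 HC] := strip_measure_le s02 dec.
have q0 : 0 < (4 * pi)^-1 :> R by rewrite invr_gt0 mulr_gt0 ?pi_gt0.
(* For [r < 1] the third bound gives [K r^2 <= K r <= (4 pi)^-1], the range where the strip estimate
   applies. *)
exists (C * K `^ (s / 2)), (Num.min r0 (Num.min 1 ((4 * pi)^-1 / K))).
split; first by rewrite mulr_gt0 ?powR_gt0.
  by rewrite !lt_min r00 ltr01 divr_gt0.
move=> r /andP[rpos]; rewrite !lt_min => /and3P[rr0 r1 rq].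
have Kr0 : 0 < K * r ^+ 2 by rewrite mulr_gt0// exprn_gt0.
have Krq : K * r ^+ 2 <= (4 * pi)^-1.
  rewrite -ler_pdivlMl// mulrC (le_trans _ (ltW rq))// expr2.
  by rewrite ler_piMl// ltW.
have := HC (gamma t0) xi (K * r ^+ 2) xi1; rewrite Kr0 Krq => /(_ isT).
set S := [set y | _] => HS; have mS : measurable S by exact: measurable_strip.
have mG : measurable (~` range gamma).
  by apply: open_measurable_plane; exact: closed_openC.
have sub : eball (gamma t0) r `<=` S `|` ~` range gamma.
  move=> y By; have [[t _ yt]|] := pselect (range gamma y); last by right.
  by left; rewrite /S /= -yt; apply: Kr; rewrite ?rpos// yt.
have le : (eta (eball (gamma t0) r) <= eta S)%E.
  rewrite -[leRHS]adde0 -G0.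
  apply: (le_trans (le_measure eta _ _ sub)); rewrite ?inE.
  - exact: measurable_eball.
  - exact: measurableU.
  - exact: measureU2.
apply: (@le_trans _ _ (fine (eta S))).
  apply: fine_le => //; apply: fin_num_measure => //; exact: measurable_eball.
apply: le_trans HS _; rewrite -mulrA ler_pM2l//.
rewrite powRM ?exprn_ge0 ?(ltW K0) ?(ltW rpos)//.
rewrite -(@powR_mulrn _ r 2) ?(ltW rpos)// -powRrM.
by rewrite mulrCA divff// mulr1.
Qed.

(** The strip estimate excludes the exponent 2, which [dimF] admits; it is reached as a limit of the
    smaller exponents [s - e], for which decay persists. *)
Lemma dimF_le (X : \bar R) :
  (forall s, 0 <= s < 2 -> fourier_decay eta s -> (s%:E <= X)%E) ->
  ((dimF eta)%:E <= X)%E.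
Proof.
move=> H.
(* Settles negative [s - e] and excludes [X] being minus infinity. *)
have H0 : (0%:E <= X)%E by apply: H; [rewrite lexx ltr0n|exact: fourier_decay0].
have HX s : 0 <= s <= 2 -> fourier_decay eta s -> (s%:E <= X)%E.
  move=> /andP[s0 s2] dec; apply/lee_subgt0Pr => e e0.
  have [se|es] := leP 0 (s - e); last first.
    by apply: le_trans H0; rewrite -EFinB lee_fin ltW.
  rewrite -EFinB; apply: H; first by rewrite se/=; lra.
  by apply: fourier_decay_le dec; rewrite gerBl ltW.
case: X H H0 HX => [x||] // _ _ HX; last by rewrite leey.
rewrite lee_fin; apply: ge_sup.
  by exists 0; split; [rewrite lexx ler0n|exact: fourier_decay0].
by move=> s [s02 dec]; rewrite -lee_fin; exact: HX.
Qed.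

End local_dimension.

(** * Comparison of the two dimensions *)

Lemma dimF_le_alpha_min (R : realType) (gamma : R -> R * R)
    (eta : {finite_measure set (R * R)%type -> \bar R}) :
  C2_Jordan_curve gamma -> regular_curve gamma -> eta (~` range gamma) = 0%E ->
  ((dimF eta)%:E <= alpha_min eta)%E.
Proof.
move=> J reg G0; apply: le_ereal_inf_tmp => _ [x sx <-].
have [per [dg _ _] _] := J.
have clG := closed_range_periodic per (derivable_continuous_plane dg).
have [t0 _ xE] := spt_subset clG G0 sx; rewrite -xE in sx *.
apply: dimF_le => s s02 dec.
have [C [r0 [C0 r00 HC]]] := curve_eball_measure_le t0 J reg G0 s02 dec.
exact: lower_local_dim_ge sx C0 r00 HC.
Qed.

Theorem proposition6p5 (R : realType) :
  (forall gamma : R -> R * R,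
     C2_Jordan_curve gamma -> regular_curve gamma ->
     forall eta : {finite_measure set (R * R)%type -> \bar R},
       eta [set: (R * R)%type] != 0%E -> eta (~` range gamma) = 0%E ->
       ((dimF eta)%:E <= alpha_min eta)%E)
  /\
  (forall gamma : R -> R * R,
     nondegenerate_C2_Jordan_curve gamma ->
     forall eta : {finite_measure set (R * R)%type -> \bar R},
       eta [set: (R * R)%type] != 0%E -> eta (~` range gamma) = 0%E ->
       ((dimF eta)%:E <= alpha_min eta)%E).
Proof.
by split=> [gamma J reg|gamma [J reg _]] eta _ G0; exact: dimF_le_alpha_min J reg G0.
Qed.
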